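(* Let $\lambda>0$ and consider the twisted $D_2Q_4$ scheme relative to $\tilde u=V=(V^x,V^y)\in\mathbb{R}^2$, with equilibrium moments $m^{eq}(V)=\rho(1,0,0,-V^xV^y)$ and relaxation parameters $s=(0,s_q,s_q,s_{xy})\in\mathbb{R}^4$. Suppose that $V^x=0$ (resp. $V^y=0$). Then the associated matrix $J(V)$ has a pre-structure of stability if and only if $|V^y|<\lambda$ (resp. $|V^x|<\lambda$). Moreover, if $0\le s_q,s_{xy}\le2$, then $J(V)$ has a structure of stability. The collision matrix $R(V)$ is then stable for $\|\cdot\|_P$ and the scheme is stable in the norm $\|\cdot\|_{P,\mathcal{L}}$, where $P$ is a matrix realizing the structure of stability.
   Context: Twisted $D_2Q_4$ scheme. Let $\Delta x,\Delta t>0$, $\lambda=\Delta x/\Delta t$, and let $\mathcal{L}$ be the lattice $\Delta x\,\mathbb{Z}^2$ or a finite periodic quotient of it. Velocities: $v_0=(\lambda,\lambda)$, $v_1=(-\lambda,\lambda)$, $v_2=(-\lambda,-\lambda)$, $v_3=(\lambda,-\lambda)$. Moment polynomials: $P_0=1$, $P_1=X$, $P_2=Y$, $P_3=XY$. For $\tilde u\in\mathbb{R}^2$, $M(\tilde u)$ is the invertible matrix $M(\tilde u)_{kj}=P_k(v_j-\tilde u)$. For $f=(f_0,\dots,f_3)$ put $\rho=\sum_jf_j$, $m=M(\tilde u)f$. One time step is: relaxation at each node $m_k^*=m_k+s_k(m_k^{eq}-m_k)$, with $m^{eq}$ a given linear function of $\rho$; $f^*=M(\tilde u)^{-1}m^*$;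 transport $f_j(x,t+\Delta t)=f_j^*(x-v_j\Delta t,t)$. Let $B$ be the matrix with $f^{eq}:=M(\tilde u)^{-1}m^{eq}=Bf$, $D=\mathrm{diag}(s)$, $J(\tilde u)=M(\tilde u)^{-1}DM(\tilde u)(B-I)$, and $R(\tilde u)=I+J(\tilde u)$ the collision matrix, so $f^*=R(\tilde u)f$; the scheme reads $f(\cdot,t+\Delta t)=T\,R(\tilde u)f(\cdot,t)$ with $T$ the transport operator. A matrix $N\in M_q(\mathbb{R})$ has a pre-structure of stability if there exist an invertible $P\in M_q(\mathbb{R})$ and vectors $a,p\in\mathbb{R}^q$ with $PNP^{-1}=-\mathrm{diag}(a)$ and ${}^tPP=\mathrm{diag}(p)$; it is a structure of stability if moreover $a_k\in[0,2]$ for all $k$. For invertible $P$ and $y\in\mathbb{R}^q$, $|y|_P=|Py|_2$ (Euclidean norm); $\|R\|_P=\sup_{|y|_P=1}|Ry|_P$; for $g:\mathcal{L}\to\mathbb{R}^q$, $\|g\|_{P,\mathcal{L}}=(\sum_{x\in\mathcal{L}}|g(x)|_P^2)^{1/2}$. An operator (the collision matrix, resp. the amplification operator $TR(\tilde u)$ of the scheme) is stable in a norm if its operator norm is at most $1$.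
   Formalization: The ''only if'' direction (pre-structure implies |V^y|<λ, resp. |V^x|<λ) is stated for (s_q,s_xy)≠(0,0); when s_q=s_xy=0 one has J(V)=0, which has a pre-structure (P=I, a=0) for every V, so the claim fails there. *)

(* Defs.v *)
From HB Require Import structures.
From mathcomp Require Import all_boot all_order all_algebra.
From mathcomp Require Import all_classical all_reals all_analysis.
From mathcomp Require Import ring.

Set Implicit Arguments.
Unset Strict Implicit.
Unset Printing Implicit Defensive.

Import Order.TTheory GRing.Theory Num.Theory.
Local Open Scope classical_set_scope.
Local Open Scope ring_scope.

Section StabilityStructures.
Context {R : realType} {q : nat}.
Implicit Types (N P : 'M[R]_q) (a p : 'rV[R]_q).

Definition pre_structure_data N P a p : Prop :=
  [/\ P \in unitmx,
      P *m N *m invmx P = - diag_mx a &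
      P^T *m P = diag_mx p].

Definition has_pre_structure N : Prop :=
  exists P a p, pre_structure_data N P a p.

Definition realizes_structure N P : Prop :=
  exists a p, pre_structure_data N P a p /\ (forall k, 0 <= a 0 k <= 2).

Definition has_structure N : Prop := exists P, realizes_structure N P.

Definition vnormP P (y : 'cV[R]_q) : R :=
  Num.sqrt (\sum_(i < q) ((P *m y) i 0) ^+ 2).

(* Suprema and norms of grid functions are taken in \bar R: the real-valued
   [sup] would be 0 on an unbounded set, and a grid function on an infinite
   lattice may fail to be square-summable. *)
Definition opnormP P (A : 'M[R]_q) : \bar R :=
  ereal_sup [set (vnormP P (A *m y))%:E | y in [set y | vnormP P y = 1]].

Definition stableP P (A : 'M[R]_q) : Prop := (opnormP P A <= 1%:E)%E.

Definition normPL (L : choiceType) P (g : L -> 'cV[R]_q) : \bar R :=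
  sqrte (\esum_(x in [set: L]) ((vnormP P (g x)) ^+ 2)%:E)%R.

Definition opnormPL (L : choiceType) P
    (A : (L -> 'cV[R]_q) -> (L -> 'cV[R]_q)) : \bar R :=
  ereal_sup [set normPL P (A g) | g in [set g | normPL P g = 1%:E]].

Definition stablePL (L : choiceType) P
    (A : (L -> 'cV[R]_q) -> (L -> 'cV[R]_q)) : Prop :=
  (opnormPL P A <= 1%:E)%E.

End StabilityStructures.

Section Lattice.
Context {R : realType}.

(* The points of dx Z^2. *)
Definition grid (dx : R) : set (R * R) :=
  [set x | exists i j : int, x = (dx * i%:~R, dx * j%:~R)].

(* L is the lattice dx Z^2 or a finite periodic quotient of it; [cls x] is the
   node of L represented by the point x. The values of [cls] outside dx Z^2
   are irrelevant. *)
Definition is_lattice (dx : R) (L : zmodType) (cls : R * R -> L) : Prop :=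
  [/\ {in grid dx &, forall x y, cls (x + y) = cls x + cls y},
      cls @` grid dx = [set: L] &
      {in grid dx &, injective cls} \/ finite_set [set: L]].

End Lattice.

Section D2Q4.
Context {R : realType}.
Implicit Types (lam : R) (u V : R * R).

Definition velocity lam (j : 'I_4) : R * R :=
  nth (0, 0) [:: (lam, lam); (- lam, lam); (- lam, - lam); (lam, - lam)] j.

Definition moment_poly (k : 'I_4) (x : R * R) : R :=
  nth 0 [:: 1; x.1; x.2; x.1 * x.2] k.

Definition moment_mx lam u : 'M[R]_4 :=
  \matrix_(k, j) moment_poly k (velocity lam j - u).

Definition density (f : 'cV[R]_4) : R := \sum_(j < 4) f j 0.

(* [e] is the vector of coefficients of the equilibrium moments:
   m^eq = rho e. *)
Definition equilibrium_moments (e f : 'cV[R]_4) : 'cV[R]_4 := density f *: e.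

(* The matrix B: column j is the image of the j-th basis vector under
   f |-> M(u)^-1 m^eq. *)
Definition equilibrium_mx lam u (e : 'cV[R]_4) : 'M[R]_4 :=
  invmx (moment_mx lam u) *m e *m (const_mx 1 : 'rV[R]_4).

Definition relaxation_jac lam u (s : 'rV[R]_4) (e : 'cV[R]_4) : 'M[R]_4 :=
  invmx (moment_mx lam u) *m diag_mx s *m moment_mx lam u
    *m (equilibrium_mx lam u e - 1%:M).

Definition collision_mx lam u (s : 'rV[R]_4) (e : 'cV[R]_4) : 'M[R]_4 :=
  1%:M + relaxation_jac lam u s e.

(* Transport over one time step: f_j(x, t + dt) = f^*_j(x - v_j dt, t). *)
Definition transport lam (dt : R) (L : zmodType) (cls : R * R -> L)
    (g : L -> 'cV[R]_4) : L -> 'cV[R]_4 :=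
  fun x => \col_j
    g (x - cls ((velocity lam j).1 * dt, (velocity lam j).2 * dt)) j 0.

Definition amplification lam (dt : R) (L : zmodType) (cls : R * R -> L)
    u (s : 'rV[R]_4) (e : 'cV[R]_4)
    (g : L -> 'cV[R]_4) : L -> 'cV[R]_4 :=
  transport lam dt cls (fun x => collision_mx lam u s e *m g x).

Definition eq_coef V : 'cV[R]_4 :=
  \col_k nth 0 [:: 1; 0; 0; - (V.1 * V.2)] k.

Definition relax_coef (sq sxy : R) : 'rV[R]_4 :=
  \row_k nth 0 [:: 0; sq; sq; sxy] k.

Lemma equilibrium_mxE lam u e f :
  equilibrium_mx lam u e *m f =
  invmx (moment_mx lam u) *m equilibrium_moments e f.
Proof.
rewrite /equilibrium_mx /equilibrium_moments -!mulmxA; congr (_ *m _).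
apply/matrixP => i j; rewrite (ord1 j) !mxE big_ord1 mxE mulrC.
by congr (_ * _); apply: eq_bigr => k _; rewrite mxE mul1r.
Qed.

Lemma moment_mx_unit lam u : 0 < lam -> moment_mx lam u \in unitmx.
Proof.
move=> lam0; have l0 : lam != 0 by rewrite gt_eqF.
pose A : 'M[R]_4 := \matrix_(j, k)
  (nth 0 [:: (1 + ((velocity lam j).1 * u.1 + (velocity lam j).2 * u.2) / lam ^+ 2
              + (velocity lam j).1 * (velocity lam j).2 * (u.1 * u.2) / lam ^+ 4);
             ((velocity lam j).1 / lam ^+ 2
              + (velocity lam j).1 * (velocity lam j).2 * u.2 / lam ^+ 4);
             ((velocity lam j).2 / lam ^+ 2
              + (velocity lam j).1 * (velocity lam j).2 * u.1 / lam ^+ 4);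
             (velocity lam j).1 * (velocity lam j).2 / lam ^+ 4] k / 4).
suff /mulmx1_unit[] : moment_mx lam u *m A = 1%:M by [].
have n4 : (4 : R) != 0 by rewrite pnatr_eq0.
apply/matrixP => i k; rewrite !mxE !big_ord_recl big_ord0 !mxE.
rewrite /moment_poly /velocity /=.
case: i => [[|[|[|[|i]]]] hi] //; case: k => [[|[|[|[|k]]]] hk] //;
  rewrite -val_eqE /=; by field.
Qed.

(* The collision matrix is the relaxation m^*_k = m_k + s_k (m^eq_k - m_k)
   read on f. *)
Lemma collision_mxE lam u s e f : 0 < lam ->
  let M := moment_mx lam u in
  let m := M *m f in
  let meq := equilibrium_moments e f in
  collision_mx lam u s e *m f =
  invmx M *m \col_k (m k 0 + s 0 k * (meq k 0 - m k 0)).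
Proof.
move=> lam0 M m meq; have Mu : M \in unitmx := moment_mx_unit u lam0.
have -> : \col_k (m k 0 + s 0 k * (meq k 0 - m k 0)) =
          m + diag_mx s *m (meq - m).
  by apply/matrixP => k j; rewrite ord1 mul_diag_mx !mxE.
rewrite /collision_mx /relaxation_jac mulmxDl mul1mx -/M [RHS]mulmxDr [in RHS]/m mulKmx//.
congr (_ + _); rewrite -!mulmxA mulmxBl mul1mx equilibrium_mxE.
by rewrite mulmxBr mulKVmx.
Qed.

End D2Q4.

(* Main.v *)
Require Import Defs.
From HB Require Import structures.
From mathcomp Require Import all_boot all_order all_algebra.
From mathcomp Require Import all_classical all_reals all_analysis.
From mathcomp Require Import ring lra.

Import Order.TTheory GRing.Theory Num.Theory.
Local Open Scope classical_set_scope.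
Local Open Scope ring_scope.

(** Write M for the moment matrix, D for the diagonal matrix of the relaxation
    parameters and e for the vector of equilibrium coefficients. When one
    component of V vanishes, e is (1,0,0,0), so D e = 0 because the density is
    conserved, and J = - M^-1 D M ([relaxation_jacE]): the rows of M are left
    eigenvectors of J.

    A pre-structure is then a question of orthogonality. If the rows of P are
    left eigenvectors of N and P^T P = diag p, then P diag(1/p) P^T = I: the
    rows of P are orthonormal for the weights w = 1/p. So for N = - M^-1 D M,
    - if the rows of M are orthogonal for some positive weights w, normalizing
      them gives P ([pre_structure_of_orthogonal]);
    - conversely, a pre-structure gives positive weights for which N is
      self-adjoint, hence for which rows of M with different relaxation
      parameters are orthogonal ([orthogonal_of_pre_structure]).

    The rows of M are 1, X - V^x, Y - V^y and (X - V^x)(Y - V^y), evaluated at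
    the four velocities (+-lam, +-lam). They are orthogonal for the law, unique
    up to scale, under which X and Y are independent with means V^x and V^y
    ([product_weight], [moment_mx_orthogonal]). This law has positive weights
    exactly when |V^x| < lam and |V^y| < lam, which gives existence. Conversely
    (say V^x = 0), orthogonality of 1 and Y - W if s_q is nonzero, or of X and
    X (Y - W) if s_q = 0 and s_xy is nonzero (recall X^2 = lam^2), says in both
    cases that W is a mean of +lam and -lam with positive weights, so that
    |W| < lam ([pre_structure_speed_bound]).

    The values a_k of any pre-structure are eigenvalues of D
    ([pre_structure_eigenvalues]), so they lie in [0,2] as soon as the relaxation
    parameters do. Then P R P^-1 = I - diag a is diagonal with entries in
    [-1,1], hence R does not increase |.|_P ([structure_contracts]). Finally
    |y|_P^2 is the sum of the p_j y_j^2, without cross terms, and transport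
    translates each component f_j separately, so it preserves the norm of a
    grid function ([normPL_transport]). *)

(** * Pre-structures of matrices conjugate to a diagonal matrix *)

Section ConjugateToDiagonal.
Context {R : realType} {q : nat}.
Implicit Types (M N P : 'M[R]_q) (a d n p w : 'rV[R]_q).

Lemma gram_diag_ge0 P p : P^T *m P = diag_mx p -> forall j, 0 <= p 0 j.
Proof.
move=> PP j; have -> : p 0 j = (P^T *m P) j j by rewrite PP mxE eqxx.
by rewrite mxE sumr_ge0// => k _; rewrite mxE -expr2 sqr_ge0.
Qed.

Lemma pre_structure_intertwines N P a p :
  pre_structure_data N P a p -> P *m N = - (diag_mx a *m P).
Proof. by case=> Pu PN _; rewrite -mulNmx -PN mulmxKV. Qed.

Lemma pre_structure_conjugate M d P a p :
  M \in unitmx ->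
  pre_structure_data (- (invmx M *m diag_mx d *m M)) P a p ->
  (P *m invmx M) *m diag_mx d = diag_mx a *m (P *m invmx M).
Proof.
move=> Mu /pre_structure_intertwines; rewrite mulmxN => /oppr_inj PN.
by rewrite (mulmxA (diag_mx a)) -PN -!mulmxA mulmxV// mulmx1.
Qed.

(** The rows of M are already orthogonal for the weights w, so P is M with its
    rows normalized. Then P diag(w) P^T = I says that P^T P is the inverse of
    diag(w). *)
Lemma pre_structure_of_orthogonal M d w n :
  M \in unitmx -> (forall i, 0 < n 0 i) -> (forall j, w 0 j != 0) ->
  M *m diag_mx w *m M^T = diag_mx n ->
  has_pre_structure (- (invmx M *m diag_mx d *m M)).
Proof.
move=> Mu n0 w0 MwM.
pose c : 'rV[R]_q := \row_i (Num.sqrt (n 0 i))^-1.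
have c0 i : Num.sqrt (n 0 i) != 0 by rewrite gt_eqF// sqrtr_gt0.
have cu : diag_mx c \in unitmx.
  by rewrite unitmxE unitfE det_diag; apply/prodf_neq0 => i _; rewrite mxE invr_eq0.
exists (diag_mx c *m M), d, (\row_j (w 0 j)^-1); split.
- by rewrite unitmx_mul cu.
- rewrite mulmxN mulNmx; congr (- _).
  apply: (canLR (mulmxK _)); first by rewrite unitmx_mul cu.
  by rewrite -!mulmxA mulKVmx// !mulmxA diag_mxC.
- rewrite trmx_mul tr_diag_mx mulmxA -(mulmxA M^T).
  have -> : diag_mx c *m diag_mx c = diag_mx (\row_i (n 0 i)^-1).
    rewrite mulmx_diag; congr diag_mx; apply/rowP => i; rewrite !mxE.
    by rewrite -invfM -expr2 sqr_sqrtr// ltW.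
  have inv_diag (v : 'rV[R]_q) : (forall i, v 0 i != 0) ->
      diag_mx v *m diag_mx (\row_i (v 0 i)^-1) = 1%:M.
    move=> v0; rewrite mulmx_diag -diag_const_mx; congr diag_mx.
    by apply/rowP => i; rewrite !mxE divff.
  have : diag_mx w *m (M^T *m diag_mx (\row_i (n 0 i)^-1) *m M) = 1%:M.
    have : M *m (diag_mx w *m M^T *m diag_mx (\row_i (n 0 i)^-1)) = 1%:M.
      by rewrite !mulmxA MwM inv_diag// => i; rewrite gt_eqF.
    by move/mulmx1C; rewrite !mulmxA.
  have /mulmx1C W1 := inv_diag w w0.
  by move=> W2; rewrite -[LHS]mul1mx -W1 -(mulmxA _ (diag_mx w)) W2 mulmx1.
Qed.

(** With w = 1/p and Q = P M^-1, the Gram matrix G = M diag(w) M^T is the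
    inverse of Q^T Q. As Q D Q^-1 = diag a is symmetric, Q^T Q commutes with D;
    hence so does G, and (d_i - d_j) G_ij = 0. *)
Lemma orthogonal_of_pre_structure M d :
  M \in unitmx -> has_pre_structure (- (invmx M *m diag_mx d *m M)) ->
  exists w, (forall j, 0 < w 0 j) /\
    forall i j, d 0 i != d 0 j -> (M *m diag_mx w *m M^T) i j = 0.
Proof.
move=> Mu [P [a [p PN]]]; have [Pu _ PP] := PN.
have p0 j : 0 < p 0 j.
  rewrite lt_neqAle; apply/andP; split.
    have : diag_mx p \in unitmx by rewrite -PP unitmx_mul unitmx_tr Pu.
    rewrite unitmxE unitfE det_diag => /prodf_neq0/(_ j isT).
    by rewrite eq_sym.
  exact: gram_diag_ge0 PP j.
pose w : 'rV[R]_q := \row_j (p 0 j)^-1.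
exists w; split=> [j|i j dij]; first by rewrite mxE invr_gt0.
pose Q := P *m invmx M.
have QD : Q *m diag_mx d = diag_mx a *m Q.
  exact: pre_structure_conjugate PN.
pose G := M *m diag_mx w *m M^T.
have GQ : G *m (Q^T *m Q) = 1%:M.
  rewrite /G /Q trmx_mul !mulmxA -(mulmxA _ M^T) trmx_inv mulmxV ?unitmx_tr//.
  rewrite mulmx1 -(mulmxA _ P^T) PP -(mulmxA M) mulmx_diag.
  have -> : diag_mx (\row_k (w 0 k * p 0 k)) = 1%:M.
    rewrite -diag_const_mx; congr diag_mx; apply/rowP => k.
    by rewrite !mxE mulVf// gt_eqF.
  by rewrite mulmx1 mulmxV.
have QGD : Q^T *m Q *m diag_mx d = diag_mx d *m (Q^T *m Q).
  have QaQ : Q^T *m diag_mx a = diag_mx d *m Q^T.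
    by rewrite -(tr_diag_mx a) -trmx_mul -QD trmx_mul tr_diag_mx.
  by rewrite -mulmxA QD !mulmxA QaQ.
have GD : diag_mx d *m G = G *m diag_mx d.
  move: (Q^T *m Q) GQ QGD => E GE ED.
  rewrite -[LHS]mul1mx -GE -mulmxA (mulmxA E) ED -(mulmxA _ E).
  by rewrite (mulmx1C GE) mulmx1.
rewrite -/G; clearbody G.
move/matrixP/(_ i j): GD; rewrite mul_diag_mx mul_mx_diag !mxE => GDij.
apply/eqP; have : (d 0 i - d 0 j) * G i j = 0.
  by rewrite mulrBl GDij mulrC subrr.
by move/eqP; rewrite mulf_eq0 subr_eq0 (negPf dij).
Qed.

(** Q = P M^-1 satisfies Q D = diag(a) Q, so Q_kj (d_j - a_k) = 0 for all j, and
    row k of the invertible Q has a nonzero entry. *)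
Lemma pre_structure_eigenvalues M d P a p :
  M \in unitmx ->
  pre_structure_data (- (invmx M *m diag_mx d *m M)) P a p ->
  forall k, exists j, a 0 k = d 0 j.
Proof.
move=> Mu PN k; have [Pu _ _] := PN.
pose Q := P *m invmx M.
have Qu : Q \in unitmx by rewrite unitmx_mul Pu unitmx_inv.
have QD : Q *m diag_mx d = diag_mx a *m Q.
  exact: pre_structure_conjugate PN.
have [j Qkj|Q0] := pickP [pred j | Q k j != 0]; last first.
  suff : row k Q = 0.
    move/(congr1 (mulmx^~ (invmx Q))); rewrite mul0mx -row_mul mulmxV// => /rowP/(_ k).
    by rewrite !mxE eqxx => /eqP; rewrite oner_eq0.
  by apply/rowP => j; rewrite [LHS]mxE [RHS]mxE; apply/eqP/negbFE/Q0.
exists j; move/matrixP/(_ k j): QD.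
clearbody Q; rewrite mul_diag_mx mul_mx_diag !mxE mulrC.
by move/(mulIf Qkj).
Qed.

End ConjugateToDiagonal.

(** * Contraction at a node *)

Section Contraction.
Context {R : realType} {q : nat}.
Implicit Types (N P : 'M[R]_q) (a p : 'rV[R]_q) (y : 'cV[R]_q).

Lemma vnormP_ge0 P y : 0 <= vnormP P y.
Proof. exact: sqrtr_ge0. Qed.

Lemma vnormP_sqr P y : vnormP P y ^+ 2 = \sum_i (P *m y) i 0 ^+ 2.
Proof. by rewrite sqr_sqrtr// sumr_ge0// => i _; rewrite sqr_ge0. Qed.

(** The absence of cross terms between components is what makes the norm
    compatible with a transport that moves each component differently. *)
Lemma vnormP_sqr_weighted P p y :
  P^T *m P = diag_mx p -> vnormP P y ^+ 2 = \sum_j p 0 j * y j 0 ^+ 2.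
Proof.
move=> PP; rewrite vnormP_sqr.
transitivity (((P *m y)^T *m (P *m y)) 0 0).
  by rewrite mxE; apply: eq_bigr => i _; rewrite [_^T _ _]mxE expr2.
rewrite trmx_mul mulmxA -(mulmxA y^T) PP -mulmxA mul_diag_mx mxE.
by apply: eq_bigr => j _; rewrite !mxE mulrCA expr2.
Qed.

(** Component i of P y is multiplied by 1 - a_i, which lies in [-1,1]. *)
Lemma structure_contracts N P y :
  realizes_structure N P -> vnormP P ((1%:M + N) *m y) <= vnormP P y.
Proof.
case=> a [p [/pre_structure_intertwines PN a02]].
apply: ler_wsqrtr; apply: ler_sum => i _.
have -> : P *m ((1%:M + N) *m y) = P *m y - diag_mx a *m (P *m y).
  by rewrite mulmxDl mul1mx mulmxDr mulmxA PN mulNmx mulmxA.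
rewrite mul_diag_mx; move: (P *m y) => z; rewrite !mxE.
have /andP[a0 a2] := a02 i.
have -> : z i 0 - a 0 i * z i 0 = (1 - a 0 i) * z i 0 by ring.
by rewrite exprMn ler_piMl ?sqr_ge0//; nra.
Qed.

Lemma structure_stableP N P : realizes_structure N P -> stableP P (1%:M + N).
Proof.
move=> NP; apply: ge_ereal_sup => _ [y /= y1 <-].
by rewrite lee_fin -[leRHS]y1; exact: structure_contracts.
Qed.

End Contraction.

(** * Transport of grid functions *)

Section GridNorm.
Context {R : realType}.

Lemma esum_translate (L : zmodType) (c : L) (F : L -> \bar R) :
  (\esum_(x in [set: L]) F (x - c)%R = \esum_(x in [set: L]) F x)%E.
Proof.
rewrite [RHS](@reindex_esum _ _ _ [set: L] [set: L] (fun x => x - c)%R)//.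
by split=> // [x y _ _ /addIr//|x _]; exists (x + c) => //=; rewrite addrK.
Qed.

(** Exchanging the sum over nodes with the sum over components leaves, for each
    j, the sum over the lattice of a translated function. *)
Lemma normPL_transport (lam dt : R) (L : zmodType) (cls : R * R -> L) P
    (p : 'rV[R]_4) (g : L -> 'cV[R]_4) :
  P^T *m P = diag_mx p -> normPL P (transport lam dt cls g) = normPL P g.
Proof.
move=> PP; congr sqrte.
have p0 j : 0 <= p 0 j := gram_diag_ge0 _ _ PP j.
have split_sum (h : L -> 'cV[R]_4) :
    (\esum_(x in [set: L]) (vnormP P (h x) ^+ 2)%:E =
     \sum_j \esum_(x in [set: L]) (p 0 j * h x j 0 ^+ 2)%:E)%E.
  rewrite -esum_sum; last by move=> *; rewrite lee_fin mulr_ge0// sqr_ge0.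
  by apply: eq_esum => x _; rewrite (vnormP_sqr_weighted _ _ _ PP) sumEFin.
rewrite !split_sum; apply: eq_bigr => j _.
rewrite -[RHS](esum_translate _ (cls ((velocity lam j).1 * dt,
                                     (velocity lam j).2 * dt))).
by apply: eq_esum => x _; rewrite mxE.
Qed.

Lemma structure_stablePL (lam dt : R) (L : zmodType) (cls : R * R -> L) u s e P :
  realizes_structure (relaxation_jac lam u s e) P ->
  stablePL P (amplification lam dt cls u s e).
Proof.
move=> JP; have [a [p [[_ _ PP] _]]] := JP.
apply: ge_ereal_sup => _ [g /= g1 <-].
rewrite /amplification (normPL_transport _ _ _ _ _ _ _ PP) -[leRHS]g1.
rewrite lee_sqrt; last first.
  by apply: esum_ge0 => x _; rewrite lee_fin sqr_ge0.
apply: le_esum => x _; rewrite lee_fin ler_sqr ?nnegrE ?vnormP_ge0//.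
exact: structure_contracts.
Qed.

End GridNorm.

(** * Moments of the twisted scheme *)

Section TwistedD2Q4.
Context {R : realType}.
Implicit Types (lam sq sxy : R) (V : R * R).

(** The equilibrium contributes M^-1 D e to each column of J. Since V^x V^y = 0,
    the only nonzero entry of e is the density, whose relaxation parameter is
    0. *)
Lemma relaxation_jacE lam V sq sxy : 0 < lam -> V.1 * V.2 = 0 ->
  let M := moment_mx lam V in
  relaxation_jac lam V (relax_coef sq sxy) (eq_coef V) =
  - (invmx M *m diag_mx (relax_coef sq sxy) *m M).
Proof.
move=> lam0 V0 M; have Mu : M \in unitmx := moment_mx_unit V lam0.
have De : diag_mx (relax_coef sq sxy) *m eq_coef V = 0.
  rewrite mul_diag_mx; apply/matrixP => k i; rewrite !mxE V0 oppr0.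
  by case: k => [[|[|[|[|k]]]] hk] //=; rewrite ?mul0r ?mulr0.
rewrite /relaxation_jac -/M mulmxBr mulmx1 /equilibrium_mx -/M.
suff -> : invmx M *m diag_mx (relax_coef sq sxy) *m M
    *m (invmx M *m eq_coef V *m (const_mx 1 : 'rV_4)) = 0 by rewrite sub0r.
by rewrite -!mulmxA mulKVmx// (mulmxA (diag_mx _)) De mul0mx mulmx0.
Qed.

(** Four times the law on the velocities under which the two coordinates are
    independent with means V^x and V^y: a variable with values in {lam, -lam}
    and mean m takes the value v with probability (1 + v m / lam^2) / 2. *)
Definition product_weight lam V : 'rV[R]_4 :=
  \row_j ((1 + (velocity lam j).1 * V.1 / lam ^+ 2)
          * (1 + (velocity lam j).2 * V.2 / lam ^+ 2)).

Lemma product_weight_gt0 lam V j : `|V.1| < lam -> `|V.2| < lam ->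
  0 < product_weight lam V 0 j.
Proof.
move=> V1 V2; have lam0 : 0 < lam by exact: le_lt_trans V1.
have factor_gt0 (v x : R) : `|x| < lam -> v = lam \/ v = - lam ->
    0 < 1 + v * x / lam ^+ 2.
  rewrite ltr_norml => /andP[x1 x2] vE.
  have -> : 1 + v * x / lam ^+ 2 = (lam ^+ 2 + v * x) / lam ^+ 2.
    by field; rewrite gt_eqF.
  by rewrite divr_gt0 ?exprn_gt0//; case: vE => ->; nra.
rewrite mxE mulr_gt0//; apply: factor_gt0 => //; rewrite /velocity;
  by case: j => [[|[|[|[|j]]]] hj] //=; auto.
Qed.

(** Independent centred variables X - V^x and Y - V^y: 1, each of them, and their
    product are pairwise orthogonal, and lam^2 - (V^x)^2 is the variance of
    X. *)
Lemma moment_mx_orthogonal lam V : 0 < lam ->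
  moment_mx lam V *m diag_mx (product_weight lam V) *m (moment_mx lam V)^T =
  diag_mx (\row_k nth 0 [:: 4; 4 * (lam ^+ 2 - V.1 ^+ 2);
                          4 * (lam ^+ 2 - V.2 ^+ 2);
                          4 * ((lam ^+ 2 - V.1 ^+ 2) * (lam ^+ 2 - V.2 ^+ 2))] k).
Proof.
move=> lam0; have l0 : lam != 0 by rewrite gt_eqF.
rewrite mul_mx_diag; apply/matrixP => i k; rewrite !mxE !big_ord_recl big_ord0 !mxE.
rewrite /moment_poly /velocity /=.
case: i => [[|[|[|[|i]]]] hi] //; case: k => [[|[|[|[|k]]]] hk] //;
  rewrite -val_eqE /=; by field.
Qed.

Lemma pre_structure_exists lam V sq sxy :
  `|V.1| < lam -> `|V.2| < lam -> V.1 * V.2 = 0 ->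
  has_pre_structure (relaxation_jac lam V (relax_coef sq sxy) (eq_coef V)).
Proof.
move=> V1 V2 V0; have lam0 : 0 < lam by exact: le_lt_trans V1.
rewrite relaxation_jacE//.
apply: pre_structure_of_orthogonal (moment_mx_orthogonal _ V lam0) => [|i|j].
- exact: moment_mx_unit.
- have variance_gt0 x : `|x| < lam -> 0 < lam ^+ 2 - x ^+ 2.
    by rewrite ltr_norml => /andP[? ?]; nra.
  by rewrite mxE; case: i => [[|[|[|[|i]]]] hi] //=; rewrite ?mulr_gt0 ?variance_gt0.
- by rewrite gt_eqF// product_weight_gt0.
Qed.

(** If s_q and s_xy both vanish then J = 0, which has a pre-structure whatever W
    is; this is why that case is excluded. *)
Lemma pre_structure_speed_bound lam V W sq sxy : 0 < lam ->
  (V.1 = 0 /\ W = V.2) \/ (V.2 = 0 /\ W = V.1) ->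
  (sq, sxy) <> (0, 0) ->
  has_pre_structure (relaxation_jac lam V (relax_coef sq sxy) (eq_coef V)) ->
  `|W| < lam.
Proof.
move=> lam0 hV s0; rewrite relaxation_jacE//; last first.
  by case: hV => -[-> _]; rewrite ?mul0r ?mulr0.
case/(orthogonal_of_pre_structure _ _ (moment_mx_unit V lam0)) => w [w0 orth].
have orth_sum (i k : 'I_4) : relax_coef sq sxy 0 i != relax_coef sq sxy 0 k ->
    \sum_j moment_poly i (velocity lam j - V) * w 0 j
            * moment_poly k (velocity lam j - V) = 0.
  move=> dik; rewrite -[RHS](orth i k dik) mul_mx_diag mxE.
  by apply: eq_bigr => j _; rewrite !mxE.
pose i1 : 'I_4 := lift ord0 ord0.
pose i2 : 'I_4 := lift ord0 (lift ord0 ord0).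
pose i3 : 'I_4 := lift ord0 (lift ord0 (lift ord0 ord0)).
(* Take the velocity coordinate corresponding to W: A and B are the total weights
   of its values lam and -lam, and the equation says that its mean is W. *)
have mean_bound (A B : R) : 0 < A -> 0 < B ->
    A * (lam - W) = B * (lam + W) -> `|W| < lam.
  by move=> A0 B0 AB; rewrite ltr_norml; apply/andP; split; nra.
have lam2_neq0 : lam ^+ 2 != 0 by rewrite expf_neq0// gt_eqF.
have [sq0|sq0] := eqVneq sq 0.
(* The first moments now have the same parameter as the density, so 1 and Y - W
   need not be orthogonal; but X and X (Y - W) are, and X^2 = lam^2 makes this
   the same condition times lam^2. *)
- have sxy0 : sxy != 0 by apply/eqP => sxy0; apply: s0; rewrite sq0 sxy0.
  case: hV => -[VE WE].
  + have := orth_sum i1 i3; rewrite !mxE /= sq0 eq_sym => /(_ sxy0).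
    rewrite !big_ord_recl big_ord0 /moment_poly /velocity /= VE -WE => orth13.
    apply: (mean_bound (w 0 ord0 + w 0 i1) (w 0 i2 + w 0 i3)); rewrite ?addr_gt0//.
    by apply: (mulfI lam2_neq0); apply/subr0_eq; rewrite -[RHS]orth13; ring.
  + have := orth_sum i2 i3; rewrite !mxE /= sq0 eq_sym => /(_ sxy0).
    rewrite !big_ord_recl big_ord0 /moment_poly /velocity /= VE -WE => orth23.
    apply: (mean_bound (w 0 ord0 + w 0 i3) (w 0 i1 + w 0 i2)); rewrite ?addr_gt0//.
    by apply: (mulfI lam2_neq0); apply/subr0_eq; rewrite -[RHS]orth23; ring.
- case: hV => -[VE WE].
  + have := orth_sum ord0 i2; rewrite !mxE /= eq_sym => /(_ sq0).
    rewrite !big_ord_recl big_ord0 /moment_poly /velocity /= -WE => orth02.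
    apply: (mean_bound (w 0 ord0 + w 0 i1) (w 0 i2 + w 0 i3)); rewrite ?addr_gt0//.
    by apply/subr0_eq; rewrite -[RHS]orth02; ring.
  + have := orth_sum ord0 i1; rewrite !mxE /= eq_sym => /(_ sq0).
    rewrite !big_ord_recl big_ord0 /moment_poly /velocity /= -WE => orth01.
    apply: (mean_bound (w 0 ord0 + w 0 i3) (w 0 i1 + w 0 i2)); rewrite ?addr_gt0//.
    by apply/subr0_eq; rewrite -[RHS]orth01; ring.
Qed.

End TwistedD2Q4.

Theorem proposition4p6 (R : realType) (dx dt : R) (hdx : 0 < dx) (hdt : 0 < dt)
    (V : R * R) (W sq sxy : R)
    (hV : (V.1 = 0 /\ W = V.2) \/ (V.2 = 0 /\ W = V.1)) :
  let lam := dx / dt in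
  let s := relax_coef sq sxy in
  let e := eq_coef V in
  let J := relaxation_jac lam V s e in
  [/\ `|W| < lam -> has_pre_structure J,
      (sq, sxy) <> (0, 0) -> has_pre_structure J -> `|W| < lam
    & has_pre_structure J -> 0 <= sq <= 2 -> 0 <= sxy <= 2 ->
      has_structure J /\
      forall P : 'M[R]_4, realizes_structure J P ->
        stableP P (collision_mx lam V s e) /\
        forall (L : zmodType) (cls : R * R -> L), is_lattice dx cls ->
          stablePL P (amplification lam dt cls V s e)].
Proof.
move=> lam s e J; have lam0 : 0 < lam by rewrite divr_gt0.
have V0 : V.1 * V.2 = 0 by case: hV => -[-> _]; rewrite ?mul0r ?mulr0.
split.
- move=> Wlam; apply: pre_structure_exists => //.
    by case: hV => -[VE WE]; rewrite ?VE ?normr0// -WE.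
  by case: hV => -[VE WE]; rewrite ?VE ?normr0// -WE.
- exact: pre_structure_speed_bound hV.
- move=> [P [a [p JP]]] sq02 sxy02; split; last first.
    move=> {JP} P JP; split=> [|L cls _]; first exact: structure_stableP.
    exact: structure_stablePL.
  exists P, a, p; split=> // k.
  move: JP; rewrite /J relaxation_jacE// => JP.
  have [j ->] := pre_structure_eigenvalues _ _ _ _ _ (moment_mx_unit V lam0) JP k.
  rewrite mxE; case: j => [[|[|[|[|j]]]] hj] //=.
  by rewrite lexx ler0n.
Qed.
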